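(* Let $\mathcal T=(G,\mathbf T^{(1)},\dots,\mathbf T^{(n)})$ be a tensor network with all $\mathbf T^{(i)}\neq0$ and contraction $\mathbf T\neq0$, and let $\epsilon>0$. Let $\delta=(\delta^{(i)})_{i=1}^n$ be a random sitewise perturbation such that all entries of all $\delta^{(i)}$ are independent with mean $0$, the entries of each $\delta^{(i)}$ have a common variance, and $\mathbb E\|\delta^{(i)}\|_F^2\le\epsilon^2\|\mathbf T^{(i)}\|_F^2$ for all $i$. Then, as $\epsilon\to0$, $$\mathbb E\,\mathscr E_r(\mathcal T,\delta)^2\le\epsilon^2\frac{\|M_{\overline{\mathcal T}}\|_F^2}{\|\overline{\mathbf T}\|_F^2}+O(\epsilon^3),$$ with equality (up to $O(\epsilon^3)$) when $\mathbb E\|\delta^{(i)}\|_F^2=\epsilon^2\|\mathbf T^{(i)}\|_F^2$ for all $i$. If instead all entries of all $\delta^{(i)}$ are independent, mean zero, with the same variance $\sigma^2$, then $\mathbb E\,\mathscr E_r(\mathcal T,\delta)^2=\sigma^2\frac{\|M_{\mathcal T}\|_F^2}{\|\mathbf T\|_F^2}+O(\sigma^3)$ as $\sigma\to0$.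
   Context: Tensor network setup: A tensor network $\mathcal T=(G,\mathbf T^{(1)},\dots,\mathbf T^{(n)})$ consists of a multigraph $G$ with vertices $v_1,\dots,v_n$, whose edges are either edges between distinct vertices (contracted legs) or self-loops (uncontracted legs), each edge having a dimension, and tensors $\mathbf T^{(j)}$ at $v_j$ with one mode per incident edge. Its contraction $\mathbf T=\mathscr T_G(\mathbf T^{(1)},\dots,\mathbf T^{(n)})$ is obtained by summing over all contracted-edge indices the product of the entries of all $\mathbf T^{(j)}$; it is multilinear in the $\mathbf T^{(j)}$. The environment matrix $M_{\mathbf T^{(j)}}$ of site $j$ is the matrix of the linear map $X\mapsto\mathrm{vec}(\mathscr T_G(\mathbf T^{(1)},\dots,X,\dots,\mathbf T^{(n)}))$ ($X$ in slot $j$) acting on $\mathrm{vec}(X)$. The environment matrix of the network is $M_{\mathcal T}=[M_{\mathbf T^{(1)}}\ \cdots\ M_{\mathbf T^{(n)}}]$, so $\|M_{\mathcal T}\|_F^2=\sum_i\|M_{\mathbf T^{(i)}}\|_F^2$. For a sitewise perturbation $\delta$ (tensors $\delta^{(i)}$ of the shapes of $\mathbf T^{(i)}$), $\hat{\mathbf T}=\mathscr T_G(\mathbf T^{(1)}+\delta^{(1)},\dots,\mathbf T^{(n)}+\delta^{(n)})$ and $\mathscr E_r(\mathcal T,\delta)=\|\hat{\mathbf T}-\mathbf T\|_F/\|\mathbf T\|_F$. Entrywise normalized network: $\overline{\mathcal T}=(G,\overline{\mathbf T}^{(1)},\dots,\overline{\mathbf T}^{(n)})$ with $\overline{\mathbf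 T}^{(j)}=\sqrt{N_j}\,\mathbf T^{(j)}/\|\mathbf T^{(j)}\|_F$, where $N_j$ is the number of entries of $\mathbf T^{(j)}$; $\overline{\mathbf T}$ is its contraction and $M_{\overline{\mathcal T}}$ its environment matrix. *)

(* Defs.v *)
From HB Require Import structures.
From mathcomp Require Import all_boot all_order all_algebra.
From mathcomp Require Import all_classical all_reals all_analysis.
Set Implicit Arguments.
Unset Strict Implicit.
Unset Printing Implicit Defensive.
Import Order.TTheory GRing.Theory Num.Theory.
Local Open Scope classical_set_scope.
Local Open Scope ring_scope.

(* A tensor network on vertices v_0..v_{n-1} ('I_n) is given by a finite     *)
(* type E of edges, the endpoints [ends e] of each edge (an edge with equal  *)
(* endpoints is a self-loop = uncontracted leg, otherwise a contracted edge  *)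
(* between distinct vertices) and the dimension [dim e] of each edge.        *)
Section TensorNetwork.
Variables (R : realType) (n : nat) (E : finType)
  (ends : E -> 'I_n * 'I_n) (dim : E -> nat).

Definition incident (j : 'I_n) (e : E) : bool :=
  ((ends e).1 == j) || ((ends e).2 == j).
Definition open_edge (e : E) : bool := (ends e).1 == (ends e).2.

Definition idx (S : pred E) := {dffun forall e : {e : E | S e}, 'I_(dim (val e))}.
Definition config := {dffun forall e : E, 'I_(dim e)}.
Definition restr (S : pred E) (x : config) : idx S :=
  [ffun e : {e : E | S e} => x (val e)].

Definition tensor (S : pred E) := idx S -> R.
Definition site_tensor (j : 'I_n) := tensor (incident j).
Definition out_tensor := tensor open_edge.

Definition nentries (S : pred E) : nat := #|{: idx S}|.
Definition frob2 (S : pred E) (t : tensor S) : R := \sum_(a : idx S) t a ^+ 2.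
Definition frob (S : pred E) (t : tensor S) : R := Num.sqrt (frob2 t).

Definition tn_contract (T : forall j : 'I_n, site_tensor j) : out_tensor :=
  fun y => \sum_(x : config | restr open_edge x == y)
             \prod_(j < n) T j (restr (incident j) x).

Definition replace_site (T : forall j : 'I_n, site_tensor j) (j : 'I_n)
  (X : site_tensor j) : forall k : 'I_n, site_tensor k :=
  @dfwith _ site_tensor T j X.

Definition unit_tensor (S : pred E) (a : idx S) : tensor S :=
  fun b => if b == a then 1 else 0.

(* environment matrix of site j: matrix of X |-> vec(contraction with X in   *)
(* slot j) acting on vec(X), vec being taken along the enumerations of the   *)
(* finite index types                                                        *)
Definition env_mx (T : forall j : 'I_n, site_tensor j) (j : 'I_n) :
  'M[R]_(#|{: idx open_edge}|, #|{: idx (incident j)}|) :=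
  \matrix_(r, c) tn_contract (replace_site T (unit_tensor (enum_val c)))
                          (enum_val r).

Definition frob2_mx (p q : nat) (M : 'M[R]_(p, q)) : R :=
  \sum_(r < p) \sum_(c < q) M r c ^+ 2.

(* ||M_T||_F^2 for the environment matrix M_T = [M_T(1) ... M_T(n)] *)
Definition env_frob2 (T : forall j : 'I_n, site_tensor j) : R :=
  \sum_(j < n) frob2_mx (env_mx T j).

Definition normalize (T : forall j : 'I_n, site_tensor j) (j : 'I_n) :
  site_tensor j :=
  fun a => Num.sqrt (nentries (incident j))%:R * T j a / frob (T j).

Definition perturb (T delta : forall j : 'I_n, site_tensor j) (j : 'I_n) :
  site_tensor j := fun a => T j a + delta j a.

Definition rel_err (T delta : forall j : 'I_n, site_tensor j) : R :=
  frob (fun y => tn_contract (perturb T delta) y - tn_contract T y) / frob (tn_contract T).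

Definition entry := {j : 'I_n & idx (incident j)}.

End TensorNetwork.

Definition independent_RVs (d : measure_display) (Omega : measurableType d)
  (R : realType) (P : probability Omega R) (I : finType)
  (X : I -> {RV P >-> R}) : Prop :=
  forall B : I -> set R, (forall i, measurable (B i)) ->
    P (\bigcap_(i in [set: I]) (X i @^-1` B i)) =
    (\prod_(i : I) P (X i @^-1` B i))%E.

Definition realize (R : realType) (n : nat) (E : finType)
  (ends : E -> 'I_n * 'I_n) (dim : E -> nat)
  (d : measure_display) (Omega : measurableType d) (P : probability Omega R)
  (X : entry ends dim -> {RV P >-> R}) (w : Omega) (j : 'I_n) :
  site_tensor R ends dim j :=
  fun a => X (existT _ j a) w.

Arguments realize {R n E ends dim d Omega P} X w j _.
Arguments normalize {R n E ends dim} T j _.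
Arguments perturb {R n E ends dim} T delta j _.

(* Main.v *)
(* Write x, x' for edge configurations with the same open indices y. The entry
   T^_y is a sum over x of products over sites, so E (T^_y - T_y)^2 is a sum over
   pairs (x, x'), and by independence each term factors over the sites:
     prod_j (T_j(x) T_j(x') + v_j [x and x' agree at j]) - prod_j T_j(x) T_j(x'),
   where v_j is the variance of the entries at site j. This is a polynomial in v
   without constant term; its linear part sums to sum_j v_j ||M_j||_F^2, and the
   rest is O(max_j v_j ^ 2). Normalizing site j by c_j multiplies ||M_j||_F^2 by
   prod_(k != j) c_k^2 and ||T||_F^2 by prod_k c_k^2, which turns the ratio for
   the normalized network into sum_j (||T_j||_F^2 / N_j) ||M_j||_F^2 / ||T||_F^2. *)
Require Import Defs.
From HB Require Import structures.
From mathcomp Require Import all_boot all_order all_algebra.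
From mathcomp Require Import all_classical all_reals all_analysis.
From mathcomp Require Import measurable_realfun.
Import Order.TTheory GRing.Theory Num.Theory.
Import HBNNSimple.
Local Open Scope classical_set_scope.
Local Open Scope ring_scope.
Set Implicit Arguments.
Unset Strict Implicit.
Unset Printing Implicit Defensive.

(** * Integrals of products: from indicators to nonnegative functions *)

(** The absolute value changes no coefficient, since the values of [h] are nonnegative. It makes
    every term visibly nonnegative, as exchanging the sum with an integral requires. *)
Lemma nnsfun_sum_indic d (T : measurableType d) (R : realType)
    (h : {nnsfun T >-> R}) :
  exists s : seq R, forall x,
    h x = \sum_(r <- s) `|r| * \1_(h @^-1` [set r]) x.
Proof.
exists (finmap.enum_fset (fset_set (range h))) => x.
rewrite fimfunE fsbig_finite//=; rewrite big_seq [RHS]big_seq.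
apply: eq_bigr => r; rewrite in_fset_set// => /set_mem[y _ <-].
by rewrite ger0_norm.
Qed.

Section integralM_comp.
Context d (Omega : measurableType d) (R : realType).
Variables (mu : {measure set Omega -> \bar R}) (Z Y : Omega -> R) (c : R).
Hypothesis mZ : measurable_fun setT Z.
Hypothesis Z0 : forall w, 0 <= Z w.
Hypothesis mY : measurable_fun setT Y.
Hypothesis c0 : 0 <= c.
Hypothesis H : forall B : set R, measurable B ->
    (\int[mu]_w (Z w * \1_B (Y w))%:E
       = c%:E * \int[mu]_w (\1_B (Y w))%:E)%E.

Let ge0_integralM_comp_nnsfun (h : {nnsfun R >-> R}) :
  (\int[mu]_w (Z w * h (Y w))%:E = c%:E * \int[mu]_w (h (Y w))%:E)%E.
Proof.
have [s hE] := nnsfun_sum_indic h.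
have mI r : measurable_fun setT (fun w => \1_(h @^-1` [set r]) (Y w) : R).
  by apply: measurableT_comp => //; apply: measurable_indic.
under eq_integral do rewrite hE mulr_sumr -sumEFin.
under [in RHS]eq_integral do rewrite hE -sumEFin.
rewrite [in RHS]ge0_integral_sum//; last first.
  by move=> r; apply/measurable_EFinP; exact: measurable_funM.
rewrite ge0_integral_sum//; last 2 first.
- by move=> r; apply/measurable_EFinP; do 2 apply: measurable_funM => //.
- by move=> r w _; rewrite lee_fin !mulr_ge0.
rewrite ge0_sume_distrr; last first.
  by move=> r _; apply: integral_ge0 => w _; rewrite lee_fin mulr_ge0.
apply: eq_bigr => r _.
under eq_integral do rewrite mulrCA EFinM.
under [in RHS]eq_integral do rewrite EFinM.
rewrite [in RHS]ge0_integralZl_EFin//; last exact/measurable_EFinP.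
rewrite ge0_integralZl_EFin//; last 2 first.
- by move=> w _; rewrite lee_fin mulr_ge0.
- by apply/measurable_EFinP; apply: measurable_funM.
by rewrite H// muleCA.
Qed.

(** [f] is an increasing limit of nonnegative simple functions, for which the identity follows from
    [H] by linearity; monotone convergence passes to the limit on both sides. In the application [Z]
    is a product of functions of the other variables and [c] is the product of their means. *)
Lemma ge0_integralM_comp (f : R -> R) :
  measurable_fun setT f -> (forall x, 0 <= f x) ->
  (\int[mu]_w (Z w * f (Y w))%:E = c%:E * \int[mu]_w (f (Y w))%:E)%E.
Proof.
move=> mf f0.
have mEf : measurable_fun setT (EFin \o f) by exact/measurable_EFinP.
pose f_ := nnsfun_approx measurableT mEf.
have cvgf y : (EFin \o f_^~ y) @ \oo --> (f y)%:E.
  apply: (@cvg_nnsfun_approx _ _ _ _ measurableT _ mEf) => // x _.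
  by rewrite lee_fin.
have mfY n : measurable_fun setT (fun w => f_ n (Y w)) by exact: measurableT_comp.
have ndf y : nondecreasing_seq (fun n => f_ n y).
  by move=> m n mn; exact/lefP/nd_nnsfun_approx.
have cvgZ : (\int[mu]_w (Z w * f_ n (Y w))%:E)%E @[n --> \oo]
    --> (\int[mu]_w (Z w * f (Y w))%:E)%E.
  rewrite (_ : (\int[mu]_w (Z w * f (Y w))%:E)%E =
      (\int[mu]_w limn (fun n => (Z w * f_ n (Y w))%:E))%E).
    apply: cvg_monotone_convergence => //.
    - by move=> n; apply/measurable_EFinP; exact: measurable_funM.
    - by move=> n w _; rewrite lee_fin mulr_ge0.
    - by move=> w _ m n mn; rewrite lee_fin ler_wpM2l// ndf.
  apply: eq_integral => w _; apply/esym/cvg_lim => //.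
  under eq_fun do rewrite EFinM.
  by rewrite EFinM; apply: cvgeZl => //; exact: cvgf.
have cvgY : (\int[mu]_w (f_ n (Y w))%:E)%E @[n --> \oo]
    --> (\int[mu]_w (f (Y w))%:E)%E.
  rewrite (_ : (\int[mu]_w (f (Y w))%:E)%E =
      (\int[mu]_w limn (fun n => (f_ n (Y w))%:E))%E).
    apply: cvg_monotone_convergence => //.
    - by move=> n; apply/measurable_EFinP.
    - by move=> n w _; rewrite lee_fin.
    - by move=> w _ m n mn; rewrite lee_fin ndf.
  by apply: eq_integral => w _; apply/esym/cvg_lim => //; exact: cvgf.
have E n := ge0_integralM_comp_nnsfun (f_ n).
have cvgcY : (c%:E * \int[mu]_w (f_ n (Y w))%:E)%E @[n --> \oo]
    --> (c%:E * \int[mu]_w (f (Y w))%:E)%E by apply: cvgeZl => //; exact: cvgY.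
by move: cvgZ; rewrite (funext E) => cvgZ; exact: (cvg_unique _ cvgZ cvgcY).
Qed.

End integralM_comp.

(** * Expectation of a product of functions of independent variables *)

Section indep_prod.
Context d (Omega : measurableType d) (R : realType) (P : probability Omega R).
Context (I : finType) (X : I -> {RV P >-> R}).
Hypothesis indepX : independent_RVs X.

Let mX i : measurable_fun setT (X i). Proof. exact: measurable_funPT. Qed.

Let integral_prod_indic (B : I -> set R) (m : I -> R) :
  (forall i, measurable (B i)) ->
  (forall i, (\int[P]_w (\1_(B i) (X i w))%:E = (m i)%:E)%E) ->
  (\int[P]_w (\prod_i \1_(B i) (X i w))%:E = (\prod_i m i)%:E)%E.
Proof.
move=> mB mE.
have mXB i : measurable (X i @^-1` B i).
  by rewrite -[X in measurable X]setTI; exact: mX.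
rewrite -prodEFin (eq_bigr (fun i => P (X i @^-1` B i))); last first.
  move=> i _; rewrite -mE -[X in _ = P X]setIT.
  by rewrite -integral_indic.
rewrite -(indepX mB) -[X in _ = P X]setIT -integral_indic//; last first.
  by apply: fin_bigcap_measurable => //; exact: finite_finset.
apply: eq_integral => w _; congr EFin.
rewrite [RHS]indicE; have [/set_mem wB|/negP nwB] := boolP (w \in _).
  by rewrite big1// => i _; rewrite indicE mem_set//; exact: wB.
have [i Bi] : exists i, ~ B i (X i w).
  by apply/existsNP => wB; apply: nwB; rewrite inE => i _; exact: wB.
by rewrite (bigD1 i)//= indicE memNset// mul0r.
Qed.

(** Induction on the list [s] of indices at which [g i] need not be an indicator. For empty [s] the
    identity is independence itself; each step frees one more index by [ge0_integralM_comp]. *)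
Let ge0_integral_prod_seq (s : seq I) (g : I -> R -> R) (m : I -> R) :
  (forall i, measurable_fun setT (g i)) -> (forall i x, 0 <= g i x) ->
  (forall i, i \notin s -> exists2 B, measurable B & g i = \1_B) ->
  (forall i, (\int[P]_w (g i (X i w))%:E = (m i)%:E)%E) ->
  (\int[P]_w (\prod_i g i (X i w))%:E = (\prod_i m i)%:E)%E.
Proof.
elim: s g m => [|i0 s IH] g m mg g0 gind mE.
  have /choice[B gB] i : exists B, measurable B /\ g i = \1_B.
    by have [//|B mB gB] := gind i; exists B.
  under eq_integral do rewrite (eq_bigr _ (fun i _ => congr1 (@^~ (X i _)) (gB i).2)).
  apply: integral_prod_indic => i; first exact: (gB i).1.
  by rewrite -mE; apply: eq_integral => w _; rewrite (gB i).2.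
have m_ge0 i : 0 <= m i.
  by rewrite -lee_fin -mE integral_ge0// => w _; rewrite lee_fin.
have mgX i : measurable_fun setT (fun w => g i (X i w)).
  exact: measurableT_comp.
under eq_integral do rewrite (bigD1 i0)//= mulrC.
rewrite (bigD1 i0)//= mulrC EFinM -mE.
apply: (@ge0_integralM_comp _ _ _ _ _ _ (\prod_(i | i != i0) m i)) => //.
- under eq_fun do rewrite -big_filter.
  exact: measurable_prod.
- by move=> w; apply: prodr_ge0.
move=> B mB.
have fPB : (\int[P]_w (\1_B (X i0 w))%:E)%E \is a fin_num.
  rewrite (_ : (\int[P]_w _)%E = P (X i0 @^-1` B)) ?fin_num_measure//.
    by rewrite -[X in measurable X]setTI; exact: mX.
  rewrite -[X in _ = P X]setIT -integral_indic//.
  by rewrite -[X in measurable X]setTI; exact: mX.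
(* Once [g i0] is replaced by [\1_B], only the indices in [s] may carry non-indicators, so the
   induction hypothesis yields the identity that [ge0_integralM_comp] asks for at [B]. *)
pose g' i := if i == i0 then \1_B else g i.
pose m' i := if i == i0 then fine (\int[P]_w (\1_B (X i0 w))%:E)%E else m i.
have := IH g' m'; rewrite (bigD1 i0)//= {2}/m' eqxx mulrC EFinM fineK//.
rewrite (eq_bigr m); last by move=> i /negPf ii0; rewrite /m' ii0.
move=> <- //.
- apply: eq_integral => w _; rewrite [in RHS](bigD1 i0)//= {1}/g' eqxx mulrC.
  congr (_ * _)%:E; apply: eq_bigr => i /negPf ii0; rewrite /g' ii0//.
- move=> i; rewrite /g'; case: eqP => // _; exact: measurable_indic.
- move=> i x; rewrite /g'; case: eqP => // _.
- move=> i si; rewrite /g'; case: eqP => [_|/eqP ii0]; first by exists B.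
  by apply: gind; rewrite inE negb_or ii0.
- move=> i; rewrite /g' /m'; case: eqP => [->|//].
  by rewrite fineK.
Qed.

Let ge0_integral_prod (g : I -> R -> R) (m : I -> R) :
  (forall i, measurable_fun setT (g i)) -> (forall i x, 0 <= g i x) ->
  (forall i, (\int[P]_w (g i (X i w))%:E = (m i)%:E)%E) ->
  (\int[P]_w (\prod_i g i (X i w))%:E = (\prod_i m i)%:E)%E.
Proof.
move=> mg g0 mE; apply: (@ge0_integral_prod_seq (enum I)) => // i.
by rewrite mem_enum.
Qed.

(** The norm of the product is the product of the norms, so the nonnegative case evaluates its
    integral as a product of finite means. *)
Lemma integrable_prod_indep (g : I -> R -> R) :
  (forall i, measurable_fun setT (g i)) ->
  (forall i, P.-integrable setT (fun w => (g i (X i w))%:E)) ->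
  P.-integrable setT (fun w => (\prod_i g i (X i w))%:E).
Proof.
move=> mg ig; have mgX i : measurable_fun setT (fun w => g i (X i w)).
  exact: measurableT_comp.
apply/integrableP; split; first by apply/measurable_EFinP; exact: measurable_prod.
under eq_integral do rewrite abse_EFin normr_prod.
rewrite (@ge0_integral_prod (fun i x => `|g i x|)
  (fun i => fine (\int[P]_w (`|g i (X i w)|)%:E)%E)) ?ltry//.
  by move=> i; apply: measurableT_comp.
move=> i; rewrite fineK// ge0_fin_numE ?integral_ge0//.
by have /integrableP[] := ig i.
Qed.

(* Expand each factor as positive minus negative part: the product becomes a
   signed sum of products of nonnegative functions of the X i. *)
Lemma integral_prod_indep (g : I -> R -> R) (m : I -> R) :
  (forall i, measurable_fun setT (g i)) ->
  (forall i, P.-integrable setT (fun w => (g i (X i w))%:E)) ->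
  (forall i, (\int[P]_w (g i (X i w))%:E = (m i)%:E)%E) ->
  (\int[P]_w (\prod_i g i (X i w))%:E = (\prod_i m i)%:E)%E.
Proof.
move=> mg ig mE.
pose h (b : bool) i x := Num.max (if b then g i x else - g i x) 0.
pose sgn (b : bool) : R := if b then 1 else -1.
have gE i x : g i x = \sum_b sgn b * h b i x.
  rewrite big_bool/= /sgn mul1r mulN1r /h.
  have [gx|/ltW gx] := leP 0 (g i x).
    by rewrite max_r ?oppr_le0// subr0.
  by rewrite max_l ?oppr_ge0// sub0r opprK.
have mh b i : measurable_fun setT (h b i).
  by apply: measurable_maxr => //; case: b => //; exact: measurableT_comp.
have h0 b i x : 0 <= h b i x by rewrite le_max lexx orbT.
have ih b i : P.-integrable setT (fun w => (h b i (X i w))%:E).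
  apply: le_integrable (ig i) => //.
    by apply/measurable_EFinP; apply: measurableT_comp.
  move=> w _; rewrite /= lee_fin ger0_norm// ge_max normr_ge0 andbT.
  by case: b; rewrite ?ler_norm// -normrN ler_norm.
pose mh_ b i := fine (\int[P]_w (h b i (X i w))%:E)%E.
have mhE b i : (\int[P]_w (h b i (X i w))%:E = (mh_ b i)%:E)%E.
  by rewrite fineK//; exact: integrable_fin_num.
have mE' i : m i = \sum_b sgn b * mh_ b i.
  apply: EFin_inj; rewrite -mE.
  under eq_integral do rewrite gE -sumEFin.
  rewrite integral_sum//=; last first.
    by move=> b; under eq_fun do rewrite EFinM; exact: integrableZl.
  rewrite -sumEFin; apply: eq_bigr => b _.
  under eq_integral do rewrite EFinM.
  by rewrite integralZl// mhE.
rewrite (eq_bigr _ (fun i _ => mE' i)) bigA_distr_bigA/=.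
have ihf (f : {ffun I -> bool}) :
    P.-integrable setT (fun w => (\prod_i h (f i) i (X i w))%:E).
  exact: (integrable_prod_indep (g := fun i => h (f i) i)).
under eq_integral do
  rewrite (eq_bigr _ (fun i _ => gE i (X i _))) bigA_distr_bigA/= -sumEFin.
rewrite integral_sum//=; last first.
  by move=> f; under eq_fun do rewrite big_split/= EFinM; exact: integrableZl.
rewrite -sumEFin; apply: eq_bigr => f _.
under eq_integral do rewrite big_split/= EFinM.
rewrite integralZl// big_split/= EFinM; congr (_ * _)%E.
exact: (@ge0_integral_prod (fun i => h (f i) i) (fun i => mh_ (f i) i)).
Qed.

End indep_prod.

(** * First-order expansion of a product, with remainder *)

(** Expand the product over the sets [J] of indices where [v i * D i] is chosen. The terms with at
    most one such index are the ones subtracted; every other term contains at least two factors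
    [v i]. *)
Lemma normr_prodD_linear (I : finType) (R : realFieldType) (A D v : I -> R) (t : R) :
  0 <= t <= 1 -> (forall i, `|v i| <= t) ->
  `|\prod_i (A i + v i * D i) - \prod_i A i
     - \sum_i v i * D i * \prod_(k | k != i) A k|
  <= t ^+ 2 * \prod_i (`|A i| + `|D i|).
Proof.
move=> /andP[t0 t1] vt.
pose term (J : {set I}) (F G : I -> R) := \prod_i (if i \in J then G i else F i).
have expand F G : \prod_i (F i + G i) = \sum_(J : {set I}) term J F G.
  by rewrite /term -bigA_distr; apply: eq_bigr => i _; rewrite addrC.
have split (P : {set I} -> R) : \sum_J P J = P finset.set0 +
    \sum_i P (finset.set1 i) + \sum_(J : {set I} | (1 < #|J|)%N) P J.
  rewrite (bigD1 finset.set0)//= -addrA; congr (_ + _).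
  rewrite (bigID (fun J : {set I} => #|J| == 1%N))/=; congr (_ + _).
    rewrite -big_cards1; apply: eq_bigl => J.
    by rewrite -cards_eq0; case: #|J| => [|[]].
  by apply: eq_bigl => J; rewrite -cards_eq0; case: #|J| => [|[]].
have term0 F G : term finset.set0 F G = \prod_i F i.
  by apply: eq_bigr => i _; rewrite finset.in_set0.
have term1 F G i : term (finset.set1 i) F G = G i * \prod_(k | k != i) F k.
  rewrite /term (bigD1 i)//= finset.in_set1 eqxx; congr (_ * _).
  by apply: eq_bigr => k /negPf ki; rewrite finset.in_set1 ki.
have term_ge0 J F G : (forall i, 0 <= F i) -> (forall i, 0 <= G i) ->
    0 <= term J F G.
  by move=> F0 G0; apply: prodr_ge0 => i _; case: ifP.
rewrite !expand split term0 (eq_bigr _ (fun i _ => term1 _ _ i)).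
rewrite [X in `|X|](_ : _ = \sum_(J : {set I} | (1 < #|J|)%N)
    term J A (fun i => v i * D i)); last first.
  set a := \prod_i A i; set b := \sum_i _; set c := \sum_(_ | _) _.
  by rewrite -(addrA a) [a + _]addrC addrK [b + c]addrC addrK.
rewrite mulr_sumr; apply: le_trans (ler_norm_sum _ _ _) _.
rewrite [leRHS](bigID (fun J : {set I} => (1 < #|J|)%N))/= -[leLHS]addr0.
apply: lerD; last first.
  by apply: sumr_ge0 => J _; rewrite mulr_ge0 ?sqr_ge0// term_ge0.
apply: ler_sum => J J1; rewrite normr_prod.
apply: (@le_trans _ _ (\prod_i ((if i \in J then t else 1) *
    (if i \in J then `|D i| else `|A i|)))).
  apply: ler_prod => i _; rewrite normr_ge0/=; case: ifP => _; last by rewrite mul1r.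
  by rewrite normrM ler_wpM2r.
rewrite big_split/= -big_mkcond prodr_const ler_wpM2r ?term_ge0//.
(* [t ^+ #|J| <= t ^+ 2], because [t <= 1] and [J] has at least two elements. *)
by rewrite ler_wiXn2l.
Qed.

(** * Integrability together with a real mean *)

(** Integrability and the value travel together, so that linear combinations are formed without
    separate integrability side conditions. *)
Definition has_mean d (Omega : measurableType d) (R : realType)
    (P : probability Omega R) (f : Omega -> R) (m : R) :=
  P.-integrable setT (fun w => (f w)%:E) /\ (\int[P]_w (f w)%:E = m%:E)%E.

Section has_mean.
Context d (Omega : measurableType d) (R : realType) (P : probability Omega R).
Implicit Types (f g : Omega -> R) (m : R).

Lemma has_mean_cst m : has_mean P (fun=> m) m.
Proof.
split; first by apply: finite_measure_integrable_cst.
by rewrite integral_cst//= probability_setT mule1.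
Qed.

Lemma has_meanD f g m1 m2 : has_mean P f m1 -> has_mean P g m2 ->
  has_mean P (fun w => f w + g w) (m1 + m2).
Proof.
move=> [fi fE] [gi gE]; split.
  by under eq_fun do rewrite EFinD; exact: integrableD.
by under eq_integral do rewrite EFinD; rewrite integralD// fE gE.
Qed.

Lemma has_meanZ f m c : has_mean P f m -> has_mean P (fun w => c * f w) (c * m).
Proof.
move=> [fi fE]; split.
  by under eq_fun do rewrite EFinM; exact: integrableZl.
by under eq_integral do rewrite EFinM; rewrite integralZl// fE.
Qed.

Lemma has_mean_sum (I : Type) (s : seq I) (Q : pred I) (f : I -> Omega -> R)
    (m : I -> R) : (forall i, has_mean P (f i) (m i)) ->
  has_mean P (fun w => \sum_(i <- s | Q i) f i w) (\sum_(i <- s | Q i) m i).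
Proof.
move=> fm; elim: s => [|i s IH].
  by under eq_fun do rewrite big_nil; rewrite big_nil; exact: has_mean_cst.
under eq_fun do rewrite big_cons; rewrite big_cons.
by case: ifP => // _; exact: has_meanD.
Qed.

Lemma has_mean_expectation f m : has_mean P f m -> 'E_P[f]%E = m%:E.
Proof. by move=> [_ fE]; rewrite unlock. Qed.

(** Over a probability measure square integrability implies integrability, and for a centred
    variable the variance is the second moment. *)
Lemma Lfun2_has_mean (X : {RV P >-> R}) (s : R) :
  (X : Omega -> R) \in Lfun P 2%:E -> ('E_P[X] = 0)%E -> ('V_P[X] = s%:E)%E ->
  has_mean P X 0 /\ has_mean P (fun w => X w ^+ 2) s.
Proof.
move=> X2 X0 Xs; split; split.
- apply/Lfun1_integrable; apply: Lfun_subset12 => //.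
  exact: fin_num_measure.
- by move: X0; rewrite unlock.
- exact: Lfun2_integrable_sqr.
- by rewrite -Xs varianceE// X0 expe2 mul0e sube0 unlock.
Qed.

End has_mean.

(** * First and second moments of products of perturbed entries *)

Section moments.
Context (R : realType) (n : nat) (E : finType) (ends : E -> 'I_n * 'I_n)
  (dim : E -> nat) (T : forall j : 'I_n, site_tensor R ends dim j).
Context d (Omega : measurableType d) (P : probability Omega R).
Context (X : entry ends dim -> {RV P >-> R}) (v : 'I_n -> R).
Hypothesis indepX : independent_RVs X.
Hypothesis X1 : forall e, has_mean P (X e) 0.
Hypothesis X2 : forall e, has_mean P (fun w => X e w ^+ 2) (v (tag e)).

(* A product over sites of one or two selected entries is written as a product
   over all entries, the unselected ones contributing the factor 1, so that
   independence of the individual entries applies directly. *)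
Let factor (c : bool) (t u : R) := if c then t + u else 1.

(** Mean of [factor c1 t u * factor c2 t u] when [u] has mean 0 and second moment [s]. *)
Let entry_mean (c1 c2 : bool) (t s : R) :=
  if c1 && c2 then t * t + s else if c1 || c2 then t else 1.

Let Tn (e : entry ends dim) := T (tagged e).

(** With [c1] and [c2] selecting the entries met by two configurations this gives the second
    moments; with [c2] empty it gives the first moments. *)
Let has_mean_entries (c1 c2 : pred (entry ends dim)) :
  has_mean P
    (fun w => \prod_e (factor (c1 e) (Tn e) (X e w) * factor (c2 e) (Tn e) (X e w)))
    (\prod_e entry_mean (c1 e) (c2 e) (Tn e) (v (tag e))).
Proof.
pose g (e : entry ends dim) u := factor (c1 e) (Tn e) u * factor (c2 e) (Tn e) u.
have mg e : measurable_fun setT (g e).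
  have mf c t : measurable_fun setT (factor c t).
    by rewrite /factor; case: c => //; exact: measurable_funD.
  exact: measurable_funM.
have gm e : has_mean P (fun w => g e (X e w))
    (entry_mean (c1 e) (c2 e) (Tn e) (v (tag e))).
  have tX : has_mean P (fun w => Tn e + X e w) (Tn e).
    by rewrite -[X in has_mean _ _ X]addr0; apply: has_meanD => //; exact: has_mean_cst.
  rewrite /g /factor /entry_mean; case: (c1 e) (c2 e) => [] []/=.
  - rewrite (_ : (fun w => _) =
      (fun w => Tn e * Tn e + 2 * Tn e * X e w + X e w ^+ 2)); last first.
      by apply/funext => w; rewrite mulrDl !mulrDr expr2 -!addrA
        [X e w * Tn e]mulrC -mulrA mulr_natl mulr2n !addrA.
    apply: has_meanD => //; rewrite -[X in has_mean _ _ X]addr0.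
    apply: has_meanD; first exact: has_mean_cst.
    by rewrite -(mulr0 (2 * Tn e)); exact: has_meanZ.
  - by under eq_fun do rewrite mulr1.
  - by under eq_fun do rewrite mul1r.
  - by under eq_fun do rewrite mulr1; exact: has_mean_cst.
split.
  by apply: (integrable_prod_indep indepX (g := g)) => // e; exact: (gm e).1.
apply: (integral_prod_indep indepX (g := g)) => // e.
  exact: (gm e).1.
exact: (gm e).2.
Qed.

Let prod_entries (F : entry ends dim -> R) :
  \prod_e F e = \prod_(j < n) \prod_(a : idx dim (incident ends j)) F (existT _ j a).
Proof.
rewrite (@sig_big_dep _ _ _ _ (fun j : 'I_n => idx dim (incident ends j) : finType)
  xpredT (fun=> xpredT) (fun j a => F (existT _ j a)))/=.
by apply: eq_bigr => -[].
Qed.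

Let prod_factor (I : finType) (p : I) (t u : I -> R) :
  \prod_a factor (a == p) (t a) (u a) = t p + u p.
Proof. by rewrite -big_mkcond big_pred1_eq. Qed.

(** The two entries selected at a site either coincide, contributing a second moment, or are
    distinct, contributing the product of their means. *)
Let prod_entry_mean (I : finType) (p q : I) (t : I -> R) (s : R) :
  \prod_a entry_mean (a == p) (a == q) (t a) s = t p * t q + s * (p == q)%:R.
Proof.
have [->|pq] := eqVneq p q.
  rewrite mulr1 (eq_bigr (fun a => if a == q then t a * t a + s else 1)).
    by rewrite -big_mkcond big_pred1_eq.
  by move=> a _; rewrite /entry_mean; case: eqP.
rewrite mulr0 addr0 (eq_bigr (fun a => (if a == p then t a else 1) *
    (if a == q then t a else 1))).
  by rewrite big_split/= -!big_mkcond !big_pred1_eq.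
move=> a _; rewrite /entry_mean; case: eqP => [->|_].
  by rewrite (negPf pq) mulr1.
by case: eqP => _; rewrite mul1r.
Qed.

Let Th w := perturb T (realize X w).

Lemma has_mean_prod_perturb (x : config dim) :
  has_mean P (fun w => \prod_(j < n) Th w (restr (incident ends j) x))
    (\prod_(j < n) T (restr (incident ends j) x)).
Proof.
pose c (e : entry ends dim) := tagged e == restr (incident ends (tag e)) x.
have := has_mean_entries c xpred0.
rewrite prod_entries; under eq_fun do rewrite prod_entries.
congr has_mean.
  apply/funext => w; apply: eq_bigr => j _.
  under eq_bigr do rewrite mulr1.
  exact: (prod_factor (restr (incident ends j) x) (@T j) (realize X w j)).
apply: eq_bigr => j _; rewrite /entry_mean/=.
under eq_bigr do rewrite andbF orbF.
by rewrite -big_mkcond; rewrite (big_pred1 (restr (incident ends j) x)).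
Qed.

Lemma has_mean_prod_perturb2 (x x' : config dim) :
  has_mean P (fun w => (\prod_(j < n) Th w (restr (incident ends j) x)) *
                       \prod_(j < n) Th w (restr (incident ends j) x'))
    (\prod_(j < n) (T (restr (incident ends j) x) * T (restr (incident ends j) x')
      + v j * (restr (incident ends j) x == restr (incident ends j) x')%:R)).
Proof.
pose c y (e : entry ends dim) := tagged e == restr (incident ends (tag e)) y.
have := has_mean_entries (c x) (c x').
rewrite prod_entries; under eq_fun do rewrite prod_entries.
congr has_mean.
  apply/funext => w; rewrite -big_split; apply: eq_bigr => j _.
  rewrite big_split; congr (_ * _).
    exact: (prod_factor (restr (incident ends j) x) (@T j) (realize X w j)).
  exact: (prod_factor (restr (incident ends j) x') (@T j) (realize X w j)).
apply: eq_bigr => j _.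
exact: (prod_entry_mean (restr (incident ends j) x)
  (restr (incident ends j) x') (@T j) (v j)).
Qed.

End moments.

Lemma frob2_ge0 (R : realType) (E : finType) (dim : E -> nat) (S : pred E)
    (t : tensor R dim S) : 0 <= frob2 t.
Proof. by apply: sumr_ge0 => a _; exact: sqr_ge0. Qed.

(** * The mean squared error as a polynomial in the site variances *)

Section excess.
Context (R : realType) (n : nat) (E : finType) (ends : E -> 'I_n * 'I_n)
  (dim : E -> nat) (T : forall j : 'I_n, site_tensor R ends dim j).

Let agree (j : 'I_n) (x x' : config dim) : R :=
  (restr (incident ends j) x == restr (incident ends j) x')%:R.

Let pair_prod (j : 'I_n) (x x' : config dim) : R :=
  T (restr (incident ends j) x) * T (restr (incident ends j) x').

(** The mean of the squared error norm when the entries at site [j] have variance [v j]. Stated free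
    of probability, it lets the asymptotics be settled uniformly over all probability spaces. *)
Definition sqr_err_mean (v : 'I_n -> R) : R :=
  \sum_(y : idx dim (open_edge ends))
    \sum_(x : config dim | restr (open_edge ends) x == y)
      \sum_(x' : config dim | restr (open_edge ends) x' == y)
        (\prod_(j < n) (pair_prod j x x' + v j * agree j x x')
         - \prod_(j < n) pair_prod j x x').

(** The entry at [(y, c)] sums, over the [x] that restrict to [c] at site [j], the product of the
    other sites. Squaring and summing over [c] keeps the pairs that agree at [j]. *)
Lemma frob2_env_mx (j : 'I_n) : frob2_mx (env_mx T j) =
  \sum_(y : idx dim (open_edge ends))
    \sum_(x : config dim | restr (open_edge ends) x == y)
      \sum_(x' : config dim | restr (open_edge ends) x' == y)
        agree j x x' * \prod_(k | k != j) pair_prod k x x'.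
Proof.
rewrite /frob2_mx.
pose F (y : idx dim (open_edge ends)) (c : idx dim (incident ends j)) : R :=
  tn_contract (replace_site T (unit_tensor R c)) y.
transitivity (\sum_y \sum_c F y c ^+ 2).
  transitivity (\sum_(y in {: idx dim (open_edge ends)})
      \sum_(c in {: idx dim (incident ends j)}) F y c ^+ 2); last first.
    by apply: eq_bigr => y _; apply: eq_bigl => c; rewrite inE.
  rewrite [RHS]big_enum_val; apply: eq_bigr => r _.
  by rewrite [RHS]big_enum_val; apply: eq_bigr => c _; rewrite mxE.
apply: eq_bigr => y _.
have FE c : F y c = \sum_(x : config dim | restr (open_edge ends) x == y)
    (restr (incident ends j) x == c)%:R *
    \prod_(k | k != j) T (restr (incident ends k) x).
  apply: eq_bigr => x _; rewrite (bigD1 j)//= /replace_site dfwithin.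
  congr (_ * _); first by rewrite /unit_tensor; case: eqP.
  by apply: eq_bigr => k kj; rewrite dfwithout// eq_sym.
under eq_bigr do rewrite FE expr2 big_distrlr/=.
rewrite exchange_big/=; apply: eq_bigr => x _.
rewrite exchange_big/=; apply: eq_bigr => x' _.
under eq_bigr do rewrite mulrACA -big_split/=.
rewrite -mulr_suml; congr (_ * _).
rewrite (bigD1 (restr (incident ends j) x))//= eqxx mul1r big1 ?addr0.
  by rewrite /agree eq_sym.
by move=> c /negPf cx; rewrite eq_sym cx mul0r.
Qed.

(** [normr_prodD_linear] is applied to each pair of configurations, with [pair_prod] as [A] and
    [agree] as [D]; [K] adds up the resulting bounds and depends on neither [v] nor [t]. *)
Lemma sqr_err_mean_linear : exists2 K : R, 0 <= K &
  forall (v : 'I_n -> R) (t : R), 0 <= t <= 1 -> (forall j, `|v j| <= t) ->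
  `|sqr_err_mean v - \sum_(j < n) v j * frob2_mx (env_mx T j)| <= t ^+ 2 * K.
Proof.
exists (\sum_(y : idx dim (open_edge ends))
    \sum_(x : config dim | restr (open_edge ends) x == y)
      \sum_(x' : config dim | restr (open_edge ends) x' == y)
        \prod_(j < n) (`|pair_prod j x x'| + `|agree j x x'|)).
  do 3 (apply: sumr_ge0 => ? _); apply: prodr_ge0 => j _; exact: addr_ge0.
move=> v t t01 vt.
have -> : \sum_(j < n) v j * frob2_mx (env_mx T j) =
  \sum_(y : idx dim (open_edge ends))
    \sum_(x : config dim | restr (open_edge ends) x == y)
      \sum_(x' : config dim | restr (open_edge ends) x' == y)
        \sum_(j < n) v j * agree j x x' * \prod_(k | k != j) pair_prod k x x'.
  under eq_bigr do rewrite frob2_env_mx mulr_sumr.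
  rewrite exchange_big/=; apply: eq_bigr => y _.
  under eq_bigr do rewrite mulr_sumr.
  rewrite exchange_big/=; apply: eq_bigr => x _.
  under eq_bigr do rewrite mulr_sumr.
  rewrite exchange_big/=; apply: eq_bigr => x' _.
  by apply: eq_bigr => j _; rewrite mulrA.
rewrite -sumrB mulr_sumr; apply: le_trans (ler_norm_sum _ _ _) _.
apply: ler_sum => y _; rewrite -sumrB mulr_sumr.
apply: le_trans (ler_norm_sum _ _ _) _.
apply: ler_sum => x _; rewrite -sumrB mulr_sumr.
apply: le_trans (ler_norm_sum _ _ _) _.
by apply: ler_sum => x' _; exact: normr_prodD_linear.
Qed.

Context d (Omega : measurableType d) (P : probability Omega R).
Context (X : entry ends dim -> {RV P >-> R}) (v : 'I_n -> R).
Hypothesis indepX : independent_RVs X.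
Hypothesis X1 : forall e, has_mean P (X e) 0.
Hypothesis X2 : forall e, has_mean P (fun w => X e w ^+ 2) (v (tag e)).

Lemma has_mean_sqr_err : has_mean P
  (fun w => frob2 (fun y => tn_contract (perturb T (realize X w)) y
                            - tn_contract T y)) (sqr_err_mean v).
Proof.
apply: has_mean_sum => y.
pose A (x : config dim) w : R :=
  \prod_(j < n) perturb T (realize X w) j (restr (incident ends j) x).
pose B (x : config dim) : R := \prod_(j < n) T (restr (incident ends j) x).
rewrite (_ : (fun w => _) = fun w =>
    \sum_(x : config dim | restr (open_edge ends) x == y)
    \sum_(x' : config dim | restr (open_edge ends) x' == y)
      (A x w * A x' w + (- B x' * A x w + (- B x * A x' w + B x * B x')))).
  apply: has_mean_sum => x; apply: has_mean_sum => x'.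
  (* Each of the two cross terms has mean [- (B x * B x')], the perturbation being centred; one of
     them cancels the constant [B x * B x']. *)
  rewrite [X in has_mean _ _ X](_ : _ =
    \prod_(j < n) (pair_prod j x x' + v j * agree j x x') +
    (- B x' * B x + (- B x * B x' + B x * B x'))); last first.
    by rewrite big_split/= !mulNr addNr addr0 [B x' * _]mulrC.
  apply: has_meanD; first exact: has_mean_prod_perturb2.
  by do 2 (apply: has_meanD; first by apply: has_meanZ; exact: has_mean_prod_perturb);
    exact: has_mean_cst.
apply/funext => w; rewrite /tn_contract -sumrB expr2 big_distrlr/=.
apply: eq_bigr => x _; apply: eq_bigr => x' _.
rewrite -/(A x w) -/(A x' w) -/(B x) -/(B x').
by rewrite mulrBl !mulrBr opprB !mulNr [A x w * B x']mulrC -addrA [- (B x * _) + _]addrC.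
Qed.

Lemma expectation_sqr_rel_err :
  ('E_P[(fun w => rel_err T (realize X w) ^+ 2)%R]
     = (sqr_err_mean v / frob2 (tn_contract T))%:E)%E.
Proof.
apply: has_mean_expectation; rewrite mulrC.
rewrite (_ : (fun w => _) = fun w => (frob2 (tn_contract T))^-1 *
    frob2 (fun y => tn_contract (perturb T (realize X w)) y - tn_contract T y)).
  exact/has_meanZ/has_mean_sqr_err.
apply/funext => w; rewrite /rel_err /frob exprMn exprVn.
by rewrite !sqr_sqrtr ?frob2_ge0// mulrC.
Qed.

End excess.

(** * The normalized network and the asymptotic estimate *)

Section normalized.
Context (R : realType) (n : nat) (E : finType) (ends : E -> 'I_n * 'I_n)
  (dim : E -> nat) (T : forall j : 'I_n, site_tensor R ends dim j).

Lemma frob2_gt0 (S : pred E) (t : tensor R dim S) a : t a != 0 -> 0 < frob2 t.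
Proof.
move=> ta; rewrite /frob2 (bigD1 a)//= ltr_wpDr ?exprn_even_gt0//.
by apply: sumr_ge0 => b _; exact: sqr_ge0.
Qed.

Hypothesis T_neq0 : forall j : 'I_n, exists a, @T j a != 0.

Lemma nentries_gt0 j : (0 < nentries dim (incident ends j))%N.
Proof. by have [a _] := T_neq0 j; apply/card_gt0P; exists a. Qed.

(** The mean square of the entries at a site. It is the inverse square of the normalizing factor,
    and [eps ^+ 2] times it is the entry variance for which the expected squared norm of the
    perturbation is [eps ^+ 2 * frob2 (T j)]. *)
Definition site_mean_sqr j : R := frob2 (@T j) / (nentries dim (incident ends j))%:R.

Lemma site_mean_sqr_gt0 j : 0 < site_mean_sqr j.
Proof.
have [a Ta] := T_neq0 j.
by rewrite divr_gt0 ?(frob2_gt0 Ta)// ltr0n nentries_gt0.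
Qed.

Lemma normalized_ratio :
  env_frob2 (normalize T) / frob2 (tn_contract (normalize T)) =
  (\sum_(j < n) site_mean_sqr j * frob2_mx (env_mx T j)) / frob2 (tn_contract T).
Proof.
pose c j := Num.sqrt (nentries dim (incident ends j))%:R / frob (@T j).
have normE j a : normalize T j a = c j * @T j a by rewrite /normalize mulrAC.
have c2 j : c j ^+ 2 = (site_mean_sqr j)^-1.
  by rewrite exprMn exprVn !sqr_sqrtr ?frob2_ge0// invf_div.
have c_neq0 j : c j ^+ 2 != 0 by rewrite c2 invr_neq0// gt_eqF// site_mean_sqr_gt0.
have prod_neq0 : \prod_j c j ^+ 2 != 0 by apply/prodf_neq0 => j _.
have -> : frob2 (tn_contract (normalize T)) =
    (\prod_j c j ^+ 2) * frob2 (tn_contract T).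
  rewrite /frob2 mulr_sumr; apply: eq_bigr => y _.
  rewrite prodrXl -exprMn /tn_contract mulr_sumr; congr (_ ^+ 2).
  by apply: eq_bigr => x _; rewrite -big_split; apply: eq_bigr => j _; exact: normE.
have envE j : frob2_mx (env_mx (normalize T) j) =
    (\prod_j c j ^+ 2) * (site_mean_sqr j * frob2_mx (env_mx T j)).
  rewrite !frob2_env_mx mulrA !mulr_sumr; apply: eq_bigr => y _.
  rewrite !mulr_sumr; apply: eq_bigr => x _.
  rewrite !mulr_sumr; apply: eq_bigr => x' _.
  rewrite [RHS]mulrCA; congr (_ * _).
  (* The left side lacks the factor [c j ^+ 2], as site [j] is removed from its environment; on the
     right this factor cancels against [site_mean_sqr j]. *)
  rewrite [X in X * site_mean_sqr j](bigD1 j)//= c2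
    [_ * site_mean_sqr j]mulrC mulVKf ?gt_eqF ?site_mean_sqr_gt0//.
  rewrite -big_split/=; apply: eq_bigr => k _.
  by rewrite !normE mulrACA.
rewrite /env_frob2 (eq_bigr _ (fun j _ => envE j)) -mulr_sumr.
by rewrite -mulf_div divff// mul1r.
Qed.

Hypothesis contract_neq0 : exists y, tn_contract T y != 0.

(** Serves both parts of the theorem: [a] is [site_mean_sqr] in the first and constantly 1 in the
    second. The remainder is quadratic in [v], hence of order [eps ^+ 4]. *)
Lemma sqr_err_mean_asymptotics (a : 'I_n -> R) : (forall j, 0 <= a j) ->
  exists C eps0 : R, 0 < eps0 /\ forall eps : R, 0 < eps < eps0 ->
    forall v : 'I_n -> R, (forall j, 0 <= v j <= eps ^+ 2 * a j) ->
    `|sqr_err_mean T v / frob2 (tn_contract T)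
      - (\sum_(j < n) v j * frob2_mx (env_mx T j)) / frob2 (tn_contract T)|
      <= C * eps ^+ 3.
Proof.
move=> a0; have [K K0 linK] := sqr_err_mean_linear T.
have [y Ty] := contract_neq0; have F0 := frob2_gt0 Ty.
set F := frob2 _ in F0 *.
pose A := \sum_j a j.
have A0 : 0 <= A by apply: sumr_ge0 => j _.
have A1 : 0 < 1 + A by rewrite ltr_pwDl.
(* The linearization is used with [t = eps ^+ 2 * A], which bounds every [v j]. The threshold
   [(1 + A)^-1] ensures both [t <= 1] and [eps <= 1], the latter giving [eps ^+ 4 <= eps ^+ 3]. *)
exists (A ^+ 2 * K / F), (1 + A)^-1; split; first by rewrite invr_gt0.
move=> eps /andP[e0 e1] v vb.
have eA : eps * (1 + A) < 1 by rewrite -ltr_pdivlMr// div1r.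
have e_le1 : eps <= 1.
  by apply: le_trans (ltW eA); rewrite ler_peMr ?(ltW e0)// lerDl.
have tA1 : eps ^+ 2 * A <= 1.
  apply: le_trans (ltW eA); rewrite expr2 -mulrA ler_wpM2l ?(ltW e0)//.
  apply: (@le_trans _ _ A); last by rewrite lerDr.
  by rewrite ler_piMl.
rewrite -mulrBl normrM [`|F^-1|]gtr0_norm ?invr_gt0//.
rewrite [leRHS](_ : _ = (A ^+ 2 * K * eps ^+ 3) / F); last by rewrite mulrAC.
rewrite ler_wpM2r ?invr_ge0 ?(ltW F0)//.
apply: (@le_trans _ _ ((eps ^+ 2 * A) ^+ 2 * K)).
  apply: linK; first by rewrite tA1 mulr_ge0// sqr_ge0.
  move=> j; have /andP[v0 vj] := vb j; rewrite ger0_norm//.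
  apply: le_trans vj _; rewrite ler_wpM2l ?sqr_ge0//.
  by rewrite /A (bigD1 j)//= lerDl sumr_ge0.
rewrite exprMn -exprM -[leLHS]mulrA [leLHS]mulrC ler_wpM2l ?mulr_ge0 ?sqr_ge0//.
by rewrite ler_wiXn2l ?(ltW e0).
Qed.

End normalized.

Unset Implicit Arguments.

Theorem mainTheorem6 (R : realType) (n : nat) (E : finType)
  (ends : E -> 'I_n * 'I_n) (dim : E -> nat)
  (T : forall j : 'I_n, site_tensor R ends dim j) :
  (forall j : 'I_n, exists a, T j a != 0) ->
  (exists y, tn_contract T y != 0) ->
  (* Part 1: sitewise variances bounded by eps^2 ||T^(i)||_F^2 *)
  (exists C eps0 : R, 0 < eps0 /\
    forall eps : R, 0 < eps < eps0 ->
    forall (d : measure_display) (Omega : measurableType d)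
      (P : probability Omega R) (X : entry ends dim -> {RV P >-> R}),
      independent_RVs X ->
      (forall e, (X e : Omega -> R) \in Lfun P 2%:E) ->
      (forall e, ('E_P[X e] = 0)%E) ->
      (forall j : 'I_n, exists s : R, forall a, 'V_P[X (existT _ j a)] = s%:E) ->
      (forall j : 'I_n,
         ('E_P[(fun w => frob2 (realize X w j))%R] <= (eps ^+ 2 * frob2 (T j))%:E)%E) ->
      ('E_P[(fun w => rel_err T (realize X w) ^+ 2)%R]
         <= (eps ^+ 2 * (env_frob2 (normalize T) / frob2 (tn_contract (normalize T)))
             + C * eps ^+ 3)%:E)%E
      /\
      ((forall j : 'I_n,
         ('E_P[(fun w => frob2 (realize X w j))%R] = (eps ^+ 2 * frob2 (T j))%:E)%E) ->
       ((eps ^+ 2 * (env_frob2 (normalize T) / frob2 (tn_contract (normalize T)))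
             - C * eps ^+ 3)%:E
         <= 'E_P[(fun w => rel_err T (realize X w) ^+ 2)%R])%E))
  /\
  (* Part 2: all entries with the same variance sigma^2 *)
  (exists C sigma0 : R, 0 < sigma0 /\
    forall sigma : R, 0 < sigma < sigma0 ->
    forall (d : measure_display) (Omega : measurableType d)
      (P : probability Omega R) (X : entry ends dim -> {RV P >-> R}),
      independent_RVs X ->
      (forall e, (X e : Omega -> R) \in Lfun P 2%:E) ->
      (forall e, ('E_P[X e] = 0)%E) ->
      (forall e, 'V_P[X e] = (sigma ^+ 2)%:E) ->
      ((sigma ^+ 2 * (env_frob2 T / frob2 (tn_contract T)) - C * sigma ^+ 3)%:E
         <= 'E_P[(fun w => rel_err T (realize X w) ^+ 2)%R])%E
      /\
      ('E_P[(fun w => rel_err T (realize X w) ^+ 2)%R]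
         <= (sigma ^+ 2 * (env_frob2 T / frob2 (tn_contract T)) + C * sigma ^+ 3)%:E)%E).
Proof.
move=> T_neq0 contract_neq0.
have env_ge0 j : 0 <= frob2_mx (env_mx T j).
  by do 2 (apply: sumr_ge0 => ? _); exact: sqr_ge0.
have [y Ty] := contract_neq0; have F0 := frob2_gt0 Ty.
split.
  (* The constants depend on [T] alone and are fixed before the probability space and the
     perturbation. *)
  have [C [eps0 [eps0_gt0 HC]]] := sqr_err_mean_asymptotics contract_neq0
    (fun j => ltW (site_mean_sqr_gt0 T_neq0 j)).
  exists C, eps0; split => // eps eps_lt d Omega P X indepX X2 X0 /choice[v Xv] Xle.
  have XM e := Lfun2_has_mean (X2 e) (X0 e).
  have X1 e : has_mean P (X e) 0.
    by case: e => j a; exact: (XM _ _ (Xv j a)).1.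
  have Xsq e : has_mean P (fun w => X e w ^+ 2) (v (tag e)).
    by case: e => j a; exact: (XM _ _ (Xv j a)).2.
  (* The number [v j] is a variance only if site [j] has an entry, which [T_neq0] supplies. *)
  have v_ge0 j : 0 <= v j.
    by have [a _] := T_neq0 j; rewrite -lee_fin -(Xv j a) variance_ge0.
  have EX j : ('E_P[(fun w => frob2 (realize X w j))%R]
      = ((nentries dim (incident ends j))%:R * v j)%:E)%E.
    apply: has_mean_expectation.
    have := @has_mean_sum _ _ _ P _ (index_enum _) xpredT _ _
      (fun a : idx dim (incident ends j) => Xsq (existT _ j a)).
    by rewrite /= sumr_const mulr_natl; apply.
  have N_gt0 j : 0 < (nentries dim (incident ends j))%:R :> R.
    by rewrite ltr0n (nentries_gt0 T_neq0).
  have v_le j : v j <= eps ^+ 2 * site_mean_sqr T j.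
    by rewrite mulrA ler_pdivlMr// mulrC -lee_fin -EX.
  have := HC eps eps_lt v; rewrite ler_distl => /(_ _)/andP[|lo hi].
    by move=> j; rewrite v_ge0 v_le.
  rewrite (expectation_sqr_rel_err T indepX X1 Xsq) (normalized_ratio T_neq0) !lee_fin.
  split.
    (* The linear part is nondecreasing in each [v j], its coefficients being squared norms, so
       [v_le] bounds it. *)
    apply: le_trans hi _; rewrite lerD2r mulrA ler_wpM2r ?invr_ge0 ?(ltW F0)//.
    by rewrite mulr_sumr ler_sum// => j _; rewrite mulrA ler_wpM2r.
  (* Equality of the expected norms provides the reverse of [v_le], hence the lower bound on the
     linear part. *)
  move=> Xeq; apply: le_trans lo; rewrite lerD2r mulrA.
  rewrite ler_wpM2r ?invr_ge0 ?(ltW F0)// mulr_sumr ler_sum// => j _.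
  rewrite mulrA ler_wpM2r// mulrA ler_pdivrMr//.
  by rewrite [leRHS]mulrC -lee_fin -Xeq EX.
(* With [a] constantly 1 and every variance equal to [s ^+ 2], the linear part is exactly
   [s ^+ 2 * env_frob2 T]. *)
have [C [eps0 [eps0_gt0 HC]]] := sqr_err_mean_asymptotics contract_neq0
    (fun=> ler01).
exists C, eps0; split => // s s_lt d Omega P X indepX X2 X0 Xv.
have XM e := Lfun2_has_mean (X2 e) (X0 e) (Xv e).
have := HC s s_lt (fun=> s ^+ 2); rewrite ler_distl => /(_ _)/andP[|lo hi].
  by move=> j; rewrite mulr1 lexx sqr_ge0.
rewrite (expectation_sqr_rel_err (v := fun=> s ^+ 2) T indepX
  (fun e => (XM e).1) (fun e => (XM e).2)).
by rewrite !lee_fin mulrA /env_frob2 mulr_sumr.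
Qed.
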